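(* Let $P_{2n}$ be the path on $2n$ vertices. Then the Lanzhou inertia of $P_{2n}$ is $In(A_{Lz}(P_{2n}))=(n,n,0)$.
   Context: Graphs are simple and undirected. For a graph $G$ on $N$ vertices, $d_G(u)$ is the degree of $u$ in $G$ and $d_{\overline{G}}(u)=N-1-d_G(u)$ is its degree in the complement $\overline{G}$. The Lanzhou matrix $A_{Lz}(G)$ is the real symmetric $N\times N$ matrix indexed by vertices whose $(u,v)$ entry is $d_G(u)d_{\overline{G}}(u)+d_G(v)d_{\overline{G}}(v)$ if $u$ and $v$ are adjacent in $G$, and $0$ otherwise. The inertia $In(M)=(n_+,n_-,n_0)$ of a real symmetric matrix $M$ gives its numbers of positive, negative and zero eigenvalues (counted with multiplicity); the Lanzhou inertia of $G$ is $In(A_{Lz}(G))$.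
   Formalization: The formal statement requires n ≥ 2: for n = 1 both vertices of P_2 have complement degree 0, so the Lanzhou matrix is zero and its inertia is (0,0,2), not (1,1,0). *)

(* Defs.v *)
From mathcomp Require Import all_boot all_order all_algebra.
From mathcomp Require Import polyrcf.

Set Implicit Arguments.
Unset Strict Implicit.
Unset Printing Implicit Defensive.

Import Order.TTheory GRing.Theory Num.Theory.

Local Open Scope ring_scope.

Record sgraph (N : nat) := SGraph {
  adj :> rel 'I_N;
  adj_sym : symmetric adj;
  adj_irr : irreflexive adj }.

Definition degree (N : nat) (G : sgraph N) (u : 'I_N) : nat :=
  #|[set v | G u v]|.

Section Complement.
Variables (N : nat) (G : sgraph N).

Definition compl_rel : rel 'I_N := fun u v => (u != v) && ~~ G u v.

Fact compl_sym : symmetric compl_rel.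
Proof. by move=> u v; rewrite /compl_rel eq_sym adj_sym. Qed.

Fact compl_irr : irreflexive compl_rel.
Proof. by move=> u; rewrite /compl_rel eqxx. Qed.

Definition compl_graph : sgraph N := SGraph compl_sym compl_irr.

Lemma degree_compl (u : 'I_N) :
  degree compl_graph u = (N - 1 - degree G u)%N.
Proof.
rewrite /degree.
have -> : [set v | compl_graph u v] = ~: (u |: [set v | G u v]).
  by apply/setP=> v; rewrite !inE negb_or [v == u]eq_sym.
by rewrite cardsCs setCK cardsU1 inE adj_irr card_ord subnDA.
Qed.

End Complement.

Section Path.
Variable N : nat.

Definition path_rel : rel 'I_N :=
  fun u v => (u.+1 == v :> nat) || (v.+1 == u :> nat).

Fact path_sym : symmetric path_rel.
Proof. by move=> u v; rewrite /path_rel orbC. Qed.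

Fact path_irr : irreflexive path_rel.
Proof. by move=> u; rewrite /path_rel orbb -[X in _ == X]addn0 -addn1 eqn_add2l. Qed.

Definition path_graph : sgraph N := SGraph path_sym path_irr.

End Path.

Definition lanzhou_weight (N : nat) (G : sgraph N) (u : 'I_N) : nat :=
  (degree G u * degree (compl_graph G) u)%N.

Definition lanzhou_mx (R : rcfType) (N : nat) (G : sgraph N) : 'M[R]_N :=
  \matrix_(u, v)
    (if G u v then (lanzhou_weight G u + lanzhou_weight G v)%:R else 0).

(* Number of eigenvalues of A in R satisfying P, each counted with its
   multiplicity as a root of the characteristic polynomial. No eigenvalue is
   missed for symmetric A, as its characteristic polynomial splits over R. *)
Definition eigen_count (R : rcfType) (N : nat) (A : 'M[R]_N) (P : pred R) :
    nat :=
  (\sum_(x <- rootsR (char_poly A) | P x) mup x (char_poly A))%N.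

Definition inertia (R : rcfType) (N : nat) (A : 'M[R]_N) : nat * nat * nat :=
  (eigen_count A (fun x => 0 < x), eigen_count A (fun x => x < 0),
   eigen_count A (fun x => x == 0)).

(* Main.v *)
(** Conjugating by the diagonal matrix of signs [(-1)^i] turns the Lanzhou matrix
    [A] of a path into [-A], because a path is bipartite; hence the spectrum of
    [A] (all real, [A] being symmetric) is invariant under negation. As all
    weights are positive for paths on at least four vertices, [v A = 0] forces
    [v = 0] when the number of vertices is even. So [0] is not an eigenvalue and
    the [2n] eigenvalues split evenly between positive and negative. *)

Require Import Defs.
From mathcomp Require Import all_boot all_order all_algebra.
From mathcomp Require Import polyrcf complex zify.

Set Implicit Arguments.
Unset Strict Implicit.
Unset Printing Implicit Defensive.

Import Order.TTheory GRing.Theory Num.Theory.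

Local Open Scope ring_scope.

(** Over polynomials, [P] intertwines ['X - A] and ['X - B]; taking determinants, the nonzero factor
    [\det P] cancels. *)
Lemma char_poly_conj (F : fieldType) (n : nat) (P A B : 'M[F]_n) :
  P \in unitmx -> P *m A = B *m P -> char_poly A = char_poly B.
Proof.
move=> uP PAB; have nzP : \det (map_mx polyC P) != 0.
  by rewrite det_map_mx polyC_eq0 -unitfE -unitmxE.
apply: (mulfI nzP); rewrite [RHS]mulrC -!det_mulmx; congr (\det _).
by rewrite /char_poly_mx mulmxBr mulmxBl -!map_mxM PAB scalar_mxC.
Qed.

Lemma char_polyN (F : fieldType) (n : nat) (A : 'M[F]_n) :
  char_poly (- A) = (-1) ^+ n * (char_poly A \Po - 'X).
Proof.
rewrite /char_poly -[_ \Po _]/((comp_poly (- 'X)) _) -det_map_mx -detZ.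
congr (\det _); apply/matrixP => i j; rewrite !mxE /=.
rewrite polyCN comp_polyB comp_polyC raddfMn /= comp_polyX mulN1r opprB.
by rewrite mulNrn !opprK addrC.
Qed.

(** Over [R[i]] the matrix is Hermitian, hence unitarily similar to a diagonal matrix with real
    entries. The resulting factorization descends to [R] because the embedding is injective on
    polynomials. *)
Lemma char_poly_symmetric_split (R : rcfType) (n : nat) (A : 'M[R]_n) :
  A^T = A -> exists s : seq R, char_poly A = \prod_(x <- s) ('X - x%:P).
Proof.
move=> symA; pose C := R[i]; pose f : {rmorphism R -> C} := real_complex R.
pose B := map_mx f A.
have realB : B \is a mxOver Num.real.
  by apply/mxOverP => i j; rewrite mxE complex_real.
have symB : B \is hermsymmx.
  apply: realsym_hermsym realB.
  by apply/is_hermitianmxP; rewrite expr0 scale1r map_mx_id // map_trmx symA.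
have /orthomx_spectralP defB := hermitian_normalmx symB.
have /mxOverP realD := hermitian_spectral_diag_real symB.
have uP := unitarymx_unit (spectral_unitarymx B).
set d := spectral_diag B in defB realD.
have PB : spectralmx B *m B = diag_mx d *m spectralmx B.
  by rewrite {2}defB !mulmxA mulmxV // mul1mx.
exists [seq complex.Re (d 0 i) | i <- enum 'I_n].
apply: (map_poly_inj f); rewrite map_char_poly -/B (char_poly_conj uP PB).
rewrite char_poly_trig ?diag_mx_is_trig // rmorph_prod /= big_map big_enum /=.
apply: eq_bigr => i _; rewrite rmorphB /= map_polyX map_polyC !mxE eqxx /=.
by rewrite mulr1n RRe_real.
Qed.

Lemma mup_prod_XsubC (F : fieldType) (x : F) (s : seq F) :
  mup x (\prod_(y <- s) ('X - y%:P)) = count_mem x s.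
Proof.
elim: s => [|y s IHs]; first by rewrite big_nil mupNroot // root1.
rewrite big_cons mupM ?polyXsubC_eq0 ?monic_neq0 ?monic_prod_XsubC // IHs /=.
by rewrite -[_ - _]expr1 mup_XsubCX; case: eqVneq.
Qed.

(** Turns a sum of multiplicities over distinct roots into a count over the list of eigenvalues with
    repetition. *)
Lemma sum_count_mem (T : eqType) (P : pred T) (r s : seq T) :
  uniq r -> {subset s <= r} ->
  (\sum_(x <- r | P x) count_mem x s)%N = count P s.
Proof.
move=> uniq_r; elim: s => [|y s IHs] sub_r /=; first by rewrite big1.
rewrite big_split /= IHs => [|z zs]; last by apply: sub_r; rewrite inE zs orbT.
have yr : y \in r by apply: sub_r; rewrite mem_head.
rewrite big_mkcond (bigD1_seq y) //= eqxx big1 => [|z]; first by case: (P y).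
by rewrite eq_sym => /negPf->; case: ifP.
Qed.

Lemma eigen_count_split (R : rcfType) (n : nat) (A : 'M[R]_n) (s : seq R)
    (P : pred R) :
  char_poly A = \prod_(x <- s) ('X - x%:P) -> eigen_count A P = count P s.
Proof.
move=> defA; rewrite /eigen_count.
have nzA : char_poly A != 0 by rewrite monic_neq0 ?char_poly_monic.
rewrite -(@sum_count_mem _ P (rootsR (char_poly A)) s) ?uniq_roots //.
  by apply: eq_bigr => x _; rewrite defA mup_prod_XsubC.
move=> x xs; rewrite -(roots_on_rootsR nzA) defA in_itv /=.
by rewrite root_prod_XsubC.
Qed.

Lemma split_antisymmetric (R : rcfType) (n : nat) (A : 'M[R]_n) (s : seq R) :
  char_poly (- A) = char_poly A -> char_poly A = \prod_(x <- s) ('X - x%:P) ->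
  perm_eq s (map -%R s).
Proof.
move=> eqNA defA.
have sz_s : size s = n.
  by apply: succn_inj; rewrite -(size_prod_XsubC s id) -defA size_char_poly.
have defNA : char_poly A = \prod_(x <- map -%R s) ('X - x%:P).
  (* As [size s = n], the sign [(-1) ^+ n] gives one [-1] to each factor:
     [- (- 'X - y) = 'X - (- y)]. *)
  rewrite -eqNA char_polyN defA rmorph_prod big_map -{1}sz_s /=.
  elim: (s) => [|y t IHt]; first by rewrite !big_nil mul1r.
  rewrite !big_cons -IHt /= exprS mulrACA; congr (_ * _).
  rewrite comp_polyB comp_polyX comp_polyC mulN1r opprB polyCN !opprK.
  by rewrite addrC.
by apply/allP => x _ /=; rewrite -!mup_prod_XsubC -defA -defNA.
Qed.

Lemma inertia_antisymmetric (R : rcfType) (m : nat) (A : 'M[R]_(2 * m)) :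
  A^T = A -> char_poly (- A) = char_poly A -> \det A != 0 ->
  inertia A = (m, m, 0%N).
Proof.
move=> symA eqNA nzA; have [s defA] := char_poly_symmetric_split symA.
rewrite /inertia !(eigen_count_split _ defA).
have sz_s : size s = (2 * m)%N.
  by apply: succn_inj; rewrite -(size_prod_XsubC s id) -defA size_char_poly.
have s0 : count (fun x : R => x == 0) s = 0%N.
  (* The constant coefficient of [char_poly A] is the determinant up to sign. *)
  apply/count_memPn; rewrite -root_prod_XsubC -defA rootE horner_coef0.
  by rewrite char_poly_det mulf_neq0 // signr_eq0.
have eq_s : count (fun x : R => 0 < x) s = count (fun x : R => x < 0) s.
  rewrite (permP (split_antisymmetric eqNA defA)) count_map.
  by apply: eq_count => x /=; rewrite oppr_gt0.
have tot : (count (fun x : R => (0 < x)%R) s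
            + count (fun x : R => (x < 0)%R) s
            + count (fun x : R => x == 0%R) s)%N = size s.
  by elim: (s) => //= x t <-; case: (ltgtP x 0) => _; lia.
move: tot; rewrite eq_s s0 sz_s => tot.
by have -> : count (fun x : R => (x < 0)%R) s = m by lia.
Qed.

(** Conjugation by the signs of the 2-colouring [c] negates the entries between distinct colours,
    and all others vanish. *)
Lemma char_polyN_bipartite (R : fieldType) (N : nat) (A : 'M[R]_N)
    (c : 'I_N -> bool) :
  (forall i j, c i = c j -> A i j = 0) -> char_poly (- A) = char_poly A.
Proof.
move=> A0; pose D : 'M[R]_N := diag_mx (\row_i (-1) ^+ c i).
have uD : D \in unitmx.
  rewrite unitmxE det_diag unitfE; apply/prodf_neq0 => i _.
  by rewrite mxE signr_eq0.
apply/esym/(char_poly_conj uD)/matrixP => i j.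
rewrite mul_diag_mx mul_mx_diag !mxE.
have [/A0->|] := eqVneq (c i) (c j); first by rewrite oppr0 mulr0 mul0r.
case: (c i) (c j) => [] [] // _;
  by rewrite ?mulrN1 ?mulN1r ?mulr1 ?mul1r ?opprK.
Qed.

Lemma lanzhou_mx_sym (R : rcfType) (N : nat) (G : sgraph N) :
  (lanzhou_mx R G)^T = lanzhou_mx R G.
Proof. by apply/matrixP => i j; rewrite !mxE adj_sym addnC. Qed.

Lemma degree_gt0 (N : nat) (G : sgraph N) (u v : 'I_N) :
  G u v -> (0 < degree G u)%N.
Proof. by move=> Guv; apply/card_gt0P; exists v; rewrite inE. Qed.

(** In coordinate [j] of [v *m lanzhou_mx R G = 0] only the term of [k] survives, and its
    coefficient is positive. *)
Lemma lanzhou_kernel_step (R : rcfType) (N : nat) (G : sgraph N)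
    (v : 'rV[R]_N) (j k : 'I_N) :
  v *m lanzhou_mx R G = 0 -> G k j -> (0 < lanzhou_weight G k)%N ->
  (forall i, G i j -> i != k -> v 0 i = 0) -> v 0 k = 0.
Proof.
move=> /matrixP/(_ 0 j) + Gkj wk v0; rewrite !mxE (bigD1 k) //= mxE Gkj.
rewrite big1 => [|i ik]; last first.
  by rewrite mxE; case: ifP => [/v0->|]; rewrite ?mul0r ?mulr0.
move/eqP; rewrite addr0 mulf_eq0 pnatr_eq0 addn_eq0 (gtn_eqF wk) orbF.
by move/eqP.
Qed.

Lemma path_lanzhou_weight_gt0 (N : nat) (u : 'I_N) :
  (3 < N)%N -> (0 < lanzhou_weight (path_graph N) u)%N.
Proof.
move=> N3; rewrite muln_gt0; apply/andP; split.
  have [u0|u0] := posnP u.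
    have h : (1 < N)%N by lia.
    by apply: (degree_gt0 (v := Ordinal h)); rewrite /= /path_rel /=; lia.
  have h : (u.-1 < N)%N by have := ltn_ord u; lia.
  by apply: (degree_gt0 (v := Ordinal h)); rewrite /= /path_rel /=; lia.
(* A non-neighbour of [u]: vertex 3 if [u] is 0 or 1, vertex 0 otherwise. *)
have [u1|u1] := leqP u 1.
  apply: (degree_gt0 (v := Ordinal N3)).
  by rewrite /= /compl_rel /= /path_rel -val_eqE /=; lia.
have h : (0 < N)%N by lia.
apply: (degree_gt0 (v := Ordinal h)).
by rewrite /= /compl_rel /= /path_rel -val_eqE /=; lia.
Qed.

(* The equation at vertex [j] relates only the two neighbours of [j]: vanishing
   propagates by steps of two from the left end to the odd vertices and from
   the right end to the even ones. *)
Lemma path_lanzhou_kernel (R : rcfType) (n : nat) (v : 'rV[R]_(2 * n)) :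
  (1 < n)%N -> v *m lanzhou_mx R (path_graph (2 * n)) = 0 -> v = 0.
Proof.
move=> n1 vA0.
have wt k : (0 < lanzhou_weight (path_graph (2 * n)) k)%N.
  by apply: path_lanzhou_weight_gt0; lia.
have odd0 m (k : 'I_(2 * n)) : (k < m)%N -> odd k -> v 0 k = 0.
  elim: m k => // m IHm k km ok.
  (* The other neighbour of [k - 1] is the odd vertex [k - 2], absent when [k = 1]. *)
  have h : (k.-1 < 2 * n)%N by have := ltn_ord k; lia.
  apply: (lanzhou_kernel_step (j := Ordinal h) vA0) => // [|i].
    by rewrite /= /path_rel /=; lia.
  by rewrite /= /path_rel -val_eqE /= => Gij ik; apply: IHm; lia.
have even0 m (k : 'I_(2 * n)) : (2 * n - k < m)%N -> ~~ odd k -> v 0 k = 0.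
  elim: m k => // m IHm k km ok.
  (* The even order of the path enters here: an even [k] is never the last vertex, so [k + 1]
     exists. *)
  have h : (k.+1 < 2 * n)%N by have := ltn_ord k; lia.
  apply: (lanzhou_kernel_step (j := Ordinal h) vA0) => // [|i].
    by rewrite /= /path_rel /=; lia.
  by rewrite /= /path_rel -val_eqE /= => Gij ik; apply: IHm; lia.
apply/rowP => k; rewrite mxE.
by case: (boolP (odd k)); [exact: odd0 k.+1 _ _|exact: even0 _.+1 _ _].
Qed.

Theorem theorem37 (R : rcfType) (n : nat) (hn : (1 < n)%N) :
  inertia (lanzhou_mx R (path_graph (2 * n))) = (n, n, 0%N).
Proof.
apply: inertia_antisymmetric; first exact: lanzhou_mx_sym.
  apply: (char_polyN_bipartite (c := fun i => odd i)) => i j cij.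
  by rewrite mxE /= /path_rel; case: ifP => //; lia.
apply/det0P => -[v /eqP nzv /(path_lanzhou_kernel hn)].
exact: nzv.
Qed.
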